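(* $k$-\textsc{in-a-Tree} parameterized by $k$ is fpt-reducible to \textsc{Minimal FVS Extension} parameterized by the size of the given set.
   Context: $k$-\textsc{in-a-Tree}: given a graph $G$ and a set $T$ of $k$ terminal vertices, decide whether there is a vertex set $T^*\supseteq T$ such that $G[T^*]$ is a tree. \textsc{Minimal FVS Extension}: given a graph $G=(V,E)$ and a set $S\subseteq V$, decide whether there exists $S^*\supseteq S$ that is a minimal feedback vertex set of $G$ (a feedback vertex set is a vertex set whose removal leaves a forest; minimal means no proper subset is a feedback vertex set). An fpt-reduction maps instances with parameter $k$ to equivalent instances with parameter bounded by a function of $k$, in time $f(k)\cdot n^{O(1)}$. *)

(* Defs.v *)
From mathcomp Require Import all_boot.
Set Implicit Arguments.
Unset Strict Implicit.
Unset Printing Implicit Defensive.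

(** * Random access machines

    The machine model is the RAM with the uniform cost measure whose only
    arithmetic operations are addition, truncated subtraction and halving.
    As there is no multiplication, register contents have length O(t + log n)
    after t steps on an input of length n, so RAM time and Turing machine time
    are polynomially related.  The input is a read-only bit string with random
    access, the output a write-only, append-only bit string.  Register indices
    and jump targets below are constants of the program. *)

Inductive instr : Type :=
  | IConst of nat & nat         (* R[a] := n *)
  | IAdd of nat & nat & nat     (* R[a] := R[b] + R[c] *)
  | ISub of nat & nat & nat     (* R[a] := R[b] - R[c] *)
  | IHalf of nat & nat          (* R[a] := R[b] / 2, rounded down *)
  | ILoad of nat & nat          (* R[a] := R[R[b]] *)
  | IStore of nat & nat         (* R[R[a]] := R[b] *)
  | ISize of nat                (* R[a] := length of the input *)
  | IRead of nat & nat          (* R[a] := input bit at position R[b] *)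
  | IWrite of nat               (* append the bit (R[a] <> 0) to the output *)
  | IJump of nat                (* go to l *)
  | IJzero of nat & nat.        (* if R[a] = 0 then go to l *)

Definition program := seq instr.

Record state : Type := State {
  pc : nat;
  regs : nat -> nat;
  out : seq bool }.

Definition upd (R : nat -> nat) (a v : nat) : nat -> nat :=
  fun b => if b == a then v else R b.

Definition exec (inp : seq bool) (i : instr) (s : state) : state :=
  let: State p R o := s in
  match i with
  | IConst a n => State p.+1 (upd R a n) o
  | IAdd a b c => State p.+1 (upd R a (R b + R c)) o
  | ISub a b c => State p.+1 (upd R a (R b - R c)) o
  | IHalf a b => State p.+1 (upd R a (R b)./2) o
  | ILoad a b => State p.+1 (upd R a (R (R b))) o
  | IStore a b => State p.+1 (upd R (R a) (R b)) o
  | ISize a => State p.+1 (upd R a (size inp)) o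
  | IRead a b => State p.+1 (upd R a (nth false inp (R b))) o
  | IWrite a => State p.+1 R (rcons o (R a != 0))
  | IJump l => State l R o
  | IJzero a l => State (if R a == 0 then l else p.+1) R o
  end.

(* A machine halts when the program counter leaves the program; halted states
   are fixed points of [step]. *)
Definition step (prog : program) (inp : seq bool) (s : state) : state :=
  if onth prog (pc s) is Some i then exec inp i s else s.

Definition init : state := State 0 (fun=> 0) [::].

Definition outputs_within (prog : program) (inp : seq bool) (t : nat)
    (res : seq bool) : Prop :=
  let s := iter t (step prog inp) init in
  size prog <= pc s /\ out s = res.

(** * Parameterized problems and fpt-reductions *)

Record param_problem : Type := ParamProblem {
  instance : Type;
  encode : instance -> seq bool;
  parameter : instance -> nat;
  yes_instance : instance -> Prop }.

(* The length of the encoding is incremented so that n^O(1) does not vanish on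
   an instance with empty encoding. *)
Definition fpt_reducible (P Q : param_problem) : Prop :=
  exists (prog : program) (f g : nat -> nat) (c : nat),
    forall x : instance P, exists y : instance Q,
      [/\ outputs_within prog (encode x)
            (f (parameter x) * (size (encode x)).+1 ^ c) (encode y),
          yes_instance x <-> yes_instance y
        & parameter y <= g (parameter x)].

(** * Graphs *)

Record sgraph : Type := SGraph {
  order_of : nat;
  adj : rel 'I_order_of;
  adj_sym : symmetric adj;
  adj_irr : irreflexive adj }.

Notation vertex G := ('I_(order_of G)).

(* The edge relation of G[A]; its vertex set is A. *)
Definition induced (G : sgraph) (A : {set vertex G}) : rel (vertex G) :=
  [rel x y | [&& x \in A, y \in A & adj x y]].

(* Cycles have at least three vertices: a single edge u -- v satisfies
   [ucycle _ [:: u; v]]. *)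
Definition is_forest (G : sgraph) (A : {set vertex G}) : Prop :=
  ~ exists c : seq (vertex G), 3 <= size c /\ ucycle (induced A) c.

Definition is_connected (G : sgraph) (A : {set vertex G}) : Prop :=
  A != set0 /\ {in A &, forall x y, connect (induced A) x y}.

Definition is_tree (G : sgraph) (A : {set vertex G}) : Prop :=
  is_connected A /\ is_forest A.

Definition is_fvs (G : sgraph) (S : {set vertex G}) : Prop :=
  is_forest (~: S).

Definition is_minimal_fvs (G : sgraph) (S : {set vertex G}) : Prop :=
  is_fvs S /\ forall S' : {set vertex G}, S' \proper S -> ~ is_fvs S'.

(** * The two problems *)

Record graph_with_set : Type := GraphWithSet {
  graph_of : sgraph;
  set_of : {set vertex graph_of} }.

(* 1^n 0, then the adjacency matrix row by row, then the characteristic vector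
   of the vertex set. *)
Definition encode_graph_with_set (I : graph_with_set) : seq bool :=
  let: GraphWithSet G A := I in
  nseq (order_of G) true ++ false ::
  [seq adj x y | x <- enum (vertex G), y <- enum (vertex G)] ++
  [seq x \in A | x <- enum (vertex G)].

Definition k_in_a_Tree : param_problem := {|
  instance := graph_with_set;
  encode := encode_graph_with_set;
  parameter := fun I => #|set_of I|;
  yes_instance := fun I =>
    exists T' : {set vertex (graph_of I)}, set_of I \subset T' /\ is_tree T' |}.

Definition Minimal_FVS_Extension : param_problem := {|
  instance := graph_with_set;
  encode := encode_graph_with_set;
  parameter := fun I => #|set_of I|;
  yes_instance := fun I =>
    exists S' : {set vertex (graph_of I)},
      set_of I \subset S' /\ is_minimal_fvs S' |}.

(* Main.v *)
Require Import Defs.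
From mathcomp Require Import all_boot zify.
Set Implicit Arguments.
Unset Strict Implicit.
Unset Printing Implicit Defensive.

(** Fix a terminal [t0] and, for every other terminal [v], add a new vertex [s_v]
    with neighbours [v] and [t0]; the given set consists of the [s_v].  A vertex
    of a minimal feedback vertex set [S] lies on a cycle that meets [S] nowhere
    else.  For [s_v] this cycle contains a path from [v] to [t0] avoiding [S], so
    all terminals lie in one tree of the forest left by [S].  Conversely, if a
    tree [A] contains the terminals, then the complement of [A] is a feedback
    vertex set, and a minimal one inside it must keep every [s_v], as [s_v]
    closes a cycle with the path of [A] from [v] to [t0]. *)

(** * Forests and minimal feedback vertex sets *)

Section Forests.
Variable G : sgraph.
Implicit Types (A B S : {set vertex G}) (x y : vertex G).

Lemma inducedE A x y : induced A x y = [&& x \in A, y \in A & adj x y].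
Proof. by []. Qed.

Lemma induced_sym A : symmetric (induced A).
Proof. by move=> x y; rewrite !inducedE adj_sym andbCA. Qed.

Lemma induced_sub A B : A \subset B -> subrel (induced A) (induced B).
Proof.
move=> /subsetP AB x y /and3P[xA yA xy].
by rewrite inducedE (AB x xA) (AB y yA).
Qed.

(** A cycle repeats no vertex, so its length is at most [#|vertex G|] and the search for one is
    finite. This boolean form makes [minset_exists] applicable. *)
Definition forestb A :=
  ~~ [exists m : 'I_(#|vertex G|.+1), (3 <= m) &&
       [exists c : m.-tuple (vertex G), ucycleb (induced A) c]].

Lemma forestP A : reflect (is_forest A) (forestb A).
Proof.
apply: (iffP idP) => [nA [c [c3 /andP[cyc uc]]]|fA].
- have lec : size c < #|vertex G|.+1.
    by rewrite ltnS -(card_uniqP uc); apply: max_card.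
  case/negP: nA; apply/existsP; exists (Ordinal lec); rewrite c3 /=.
  by apply/existsP; exists (in_tuple c); apply/andP.
- apply/negP => /existsP[m /andP[m3 /existsP[c cyc]]]; apply: fA.
  by exists c; rewrite size_tuple; split.
Qed.

Lemma minimal_fvs_exists S :
  is_fvs S -> exists2 S', is_minimal_fvs S' & S' \subset S.
Proof.
move=> fS; have pS : forestb (~: S) by apply/forestP.
have [S' /minsetP[/forestP fS' minS'] sub] :=
  minset_exists (P := fun B => forestb (~: B)) pS.
exists S' => //; split=> // B /properP[BS' [x xS' xB]] fB.
have eqB : B = S' by apply: minS' => //; apply/forestP.
by rewrite eqB xS' in xB.
Qed.

Lemma singleton_is_tree x : is_tree [set x].
Proof.
split; [split|].
- by apply/set0Pn; exists x; rewrite set11.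
- by move=> y z /set1P-> /set1P->.
- move=> [[|a [|b c]] [//= c3 /andP[/andP[/and3P[/set1P-> /set1P->]]]]].
  by rewrite adj_irr.
Qed.

(* The rest of a cycle of the graph induced by [s |: A] that closes at [s] is a
   path avoiding [s] between two distinct neighbours of [s]. *)
Lemma private_cycle A s :
  s \notin A -> is_forest A -> ~ is_forest (s |: A) ->
  exists x y, [/\ x != y, adj s x & adj s y] /\
    [/\ x \in A, y \in A & connect (induced A) x y].
Proof.
move=> sA fA /(introN (forestP _)); rewrite negbK => /existsP[m /andP[m3 /existsP[c0]]].
rewrite -{}(size_tuple c0) in m3; case: c0 m3 => c /= _ c3 /andP[cyc uc].
have cA : {subset c <= s |: A}.
  move=> z zc; have := next_cycle cyc zc.
  by case/and3P.
have toA p x : path (induced (s |: A)) x p -> s \notin x :: p ->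
    path (induced A) x p.
  elim: p x => //= y p IH x /andP[/and3P[xA yA xy] pp].
  rewrite !inE !negb_or => /and3P[sx sy sp].
  rewrite (IH y pp) ?inE ?negb_or ?sy // andbT.
  move: xA yA; rewrite inducedE !in_setU1 ![_ == s]eq_sym (negbTE sx) (negbTE sy) /=.
  by move=> -> ->; rewrite xy.
have [sc|sNc] := boolP (s \in c); last first.
  case: fA; exists c; split=> //; apply/andP; split=> //.
  case: c cyc sNc {c3 uc cA} => //= x p cyc sNc; apply: toA => //.
  by rewrite inE mem_rcons (negbTE sNc) orbF; case/norP: sNc.
(* Rotated to start at [s], the cycle has at least two further vertices and no repetition, so the
   first and the last of them differ. *)
have [i p defp] := rot_to sc.
have sz : size p >= 2 by move: c3; rewrite -(size_rot i) defp.
move: cyc uc; rewrite -(rot_cycle i) -(rot_uniq i) {}defp /=.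
case: p sz => // x [//|y p] _.
rewrite rcons_cons /= rcons_path => /and3P[sx xy /andP[pp ps]].
case/andP=> sN /andP[xN _].
exists x, (last y p); split; split.
- by apply: contraNneq xN => ->; apply: mem_last.
- by case/and3P: sx.
- by rewrite adj_sym; case/and3P: ps.
- case/and3P: sx => _; rewrite in_setU1 => /orP[/eqP xs|//].
  by rewrite xs mem_head in sN.
- case/and3P: ps; rewrite in_setU1 => /orP[/eqP ys|//].
  by rewrite -ys inE mem_last orbT in sN.
- by apply/connectP; exists (y :: p) => //; apply: toA => //=; rewrite xy.
Qed.

End Forests.

(** * Hanging the extra vertices on the terminals *)

Section Reduction.
(** [f] embeds [G] into [H]. Some vertices of [H] may be neither in this copy nor hung on a
    terminal, as the concrete graph provides an [s v] for every [v]; [adj_s] keeps them apart from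
    the copy. [t0_T] is conditional so that [T] may be empty. *)
Variables (G H : sgraph) (T : {set vertex G}) (t0 : vertex G).
Variables (f s : vertex G -> vertex H).
Hypothesis f_inj : injective f.
Hypothesis f_adj : forall x y, adj (f x) (f y) = adj x y.
Hypothesis s_codom : forall v, s v \notin codom f.
Hypothesis s_adj : forall v, v \in T :\ t0 ->
  forall z, adj (s v) z = (z == f v) || (z == f t0).
Hypothesis adj_s : forall x z, z \notin codom f -> adj (f x) z ->
  z \in s @: (T :\ t0).
Hypothesis t0_T : T != set0 -> t0 \in T.

Lemma cycle_image A c :
  ucycle (induced A) c -> ucycle (induced (f @: A)) (map f c).
Proof.
case/andP=> cyc uc; apply/andP; split; last by rewrite map_inj_uniq.
rewrite cycle_map; apply: sub_cycle cyc => x y /and3P[xA yA xy].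
by rewrite /= inducedE !imset_f // f_adj.
Qed.

Lemma forest_image A : is_forest A -> is_forest (f @: A).
Proof.
move=> fA [c [c3 /andP[cyc uc]]]; apply: fA.
have imc : {subset c <= f @: A}.
  by move=> z zc; case/and3P: (next_cycle cyc zc).
have [d defc] : exists d, c = map f d.
  elim: c imc {c3 cyc uc} => [|z c IH] imc; first by exists [::].
  have [|d ->] := IH; first by move=> u uc; rewrite imc ?inE ?uc ?orbT.
  have /imsetP[x _ ->] := imc z (mem_head _ _).
  by exists (x :: d).
exists d; move: c3; rewrite defc size_map => c3; split=> //.
apply/andP; split; last by move: uc; rewrite defc map_inj_uniq.
move: cyc; rewrite defc cycle_map; apply: sub_cycle => x y.
by rewrite /= !inducedE !mem_imset // f_adj.
Qed.

Lemma tree_of_minimal_fvs (S : {set vertex H}) :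
  s @: (T :\ t0) \subset S -> is_minimal_fvs S ->
  exists2 A : {set vertex G}, T \subset A & is_tree A.
Proof.
move=> /subsetP sS [fS minS].
(* Without a terminal other than [t0], no [s v] keeps [f t0] out of [S], but [[set t0]] serves as
   the tree. *)
have [T0|] := eqVneq (T :\ t0) set0.
  exists [set t0]; last exact: singleton_is_tree.
  by rewrite -setD_eq0 T0.
case/set0Pn=> v0 v0T.
(* Minimality at [s v]: returning it to the forest creates a cycle, on which its two neighbours can
   only be [f v] and [f t0]. *)
have link v : v \in T :\ t0 ->
    [/\ f v \in ~: S, f t0 \in ~: S & connect (induced (~: S)) (f t0) (f v)].
  move=> vT; have svS : s v \in S by rewrite sS // imset_f.
  have prop : S :\ s v \proper S by rewrite properD1.
  have := minS _ prop; rewrite /is_fvs setCD setUC => nf.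
  have svA : s v \notin ~: S by rewrite inE negbK.
  have [x [y [[xy]]]] := private_cycle svA fS nf.
  rewrite !s_adj // => /orP[] /eqP ex /orP[] /eqP ey; move: xy;
    rewrite ex ey ?eqxx //.
  - move=> _ [h1 h2 h]; split=> //.
    by rewrite (sym_connect_sym (induced_sym _)).
  - by move=> _ [h1 h2 h]; split.
(* The tree is the component of [f t0] outside [S], pulled back to [G]. *)
exists [set x | (f x \in ~: S) && connect (induced (~: S)) (f t0) (f x)].
  apply/subsetP=> v vT; rewrite inE.
  have [->|vt0] := eqVneq v t0.
    by have [_ -> _] := link _ v0T; rewrite connect0.
  by have [|-> _ ->] := link v; rewrite // !inE vt0.
set A := [set x | _].
have t0A : t0 \in A by have [_ h _] := link _ v0T; rewrite inE h connect0.
(* A path from [f t0] outside [S] cannot leave the copy of [G]: its first vertex beyond the copy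
   would be some [s v], which lies in [S]. *)
have fromt0 x : x \in A -> connect (induced A) t0 x.
  rewrite inE => /andP[_ /connectP[p]].
  elim/last_ind: p x => [|p z IH] x /=; first by move=> _ /f_inj->.
  rewrite rcons_path last_rcons => /andP[pp /and3P[lS zS lz]] defz.
  have [w defw] : exists w, last (f t0) p = f w.
    have [/codomP[w ->]|lN] := boolP (last (f t0) p \in codom f); first by exists w.
    have := adj_s (x := x) lN; rewrite defz adj_sym lz => /(_ isT)/sS.
    by move: lS; rewrite inE => /negbTE->.
  have wA : w \in A.
    by rewrite inE -defw lS; apply/connectP; exists p.
  apply: connect_trans (IH w pp (esym defw)) _; apply: connect1.
  rewrite inducedE wA -f_adj -defw defz lz andbT in_set defz zS.
  apply/connectP; exists (rcons p z); last by rewrite last_rcons.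
  by rewrite rcons_path pp inducedE lS zS.
split; [split|].
- by apply/set0Pn; exists t0.
- move=> x y xA yA; apply: connect_trans (fromt0 y yA).
  by rewrite (sym_connect_sym (induced_sym _)) fromt0.
- move=> [c [c3 cyc]]; apply: fS; exists (map f c); rewrite size_map; split=> //.
  have [cyc' uc] := andP (cycle_image cyc).
  apply/andP; split=> //; apply: sub_cycle cyc'; apply: induced_sub.
  by apply/subsetP=> _ /imsetP[x /[!inE] /andP[xS _] ->].
Qed.

Lemma minimal_fvs_of_tree (A : {set vertex G}) :
  T \subset A -> is_tree A ->
  exists2 S : {set vertex H}, s @: (T :\ t0) \subset S & is_minimal_fvs S.
Proof.
move=> /subsetP TA [[_ conA] fA].
have [|S minS] := @minimal_fvs_exists H (~: (f @: A)).
  by rewrite /is_fvs setCK; apply: forest_image.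
rewrite -setCS setCK => AS; exists S => //.
apply/subsetP=> _ /imsetP[v vT0 ->]; apply/negP => /negP svS.
have [vt0 vT] := setD1P vT0; have t0T : t0 \in T.
  by apply: t0_T; apply/set0Pn; exists v.
have /connectP[p0 pp0 lp0] := conA _ _ (TA _ t0T) (TA _ vT).
case/shortenP: pp0 lp0 => p pp up _ lp.
have pA : {subset t0 :: p <= A}.
  move: pp (TA _ t0T) => {up lp}.
  elim: p t0 => [|y p IH] x /=; first by move=> _ xA z; rewrite inE => /eqP->.
  case/andP=> /and3P[_ yA _] pp xA z; rewrite inE => /predU1P[->//|].
  exact: IH.
have inS x : x \in A -> f x \in ~: S by move=> xA; rewrite (subsetP AS) ?imset_f.
(* The cycle goes from [s v] to [t0], along the tree path to [v], and back. As [v] differs from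
   [t0], [p] is nonempty, which gives three vertices. *)
case: minS.1; exists (s v :: map f (t0 :: p)); split.
  case: p lp {pp up pA} => //= eq_v.
  by rewrite eq_v eqxx in vt0.
apply/andP; split; last first.
  rewrite cons_uniq map_inj_uniq // up andbT.
  apply: contra (s_codom v) => /mapP[x _ ->]; exact: codom_f.
rewrite (cycle_path (s v)) /= last_map -lp.
have svC : s v \in ~: S by rewrite in_setC.
rewrite !inducedE svC !inS ?TA // adj_sym !s_adj // !eqxx orbT /=.
rewrite path_map; apply: sub_path pp => x y /and3P[xA yA xy].
by rewrite /= inducedE !inS // f_adj.
Qed.

End Reduction.
(** * Structured programs for the random access machine *)

Inductive cmd : Type :=
  | Do of instr
  | Seq of cmd & cmd
  | If of nat & cmd & cmd
  | While of nat & cmd.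

Declare Scope cmd_scope.
Delimit Scope cmd_scope with C.
Bind Scope cmd_scope with cmd.
Notation "c1 ;; c2" := (Seq c1 c2)
  (at level 80, right associativity) : cmd_scope.
Coercion Do : instr >-> cmd.

Fixpoint csize (c : cmd) : nat :=
  match c with
  | Do _ => 1
  | Seq c1 c2 => csize c1 + csize c2
  | If _ c1 c2 => (csize c1 + csize c2).+2
  | While _ c1 => (csize c1).+2
  end.

(* [l] is the address of the first instruction, as jump targets are absolute. *)
Fixpoint compile (l : nat) (c : cmd) : program :=
  match c with
  | Do i => [:: i]
  | Seq c1 c2 => compile l c1 ++ compile (l + csize c1) c2
  | If r c1 c2 =>
      IJzero r (l + csize c1).+2 :: compile l.+1 c1 ++
      IJump (l + (csize c1 + csize c2).+2) :: compile (l + csize c1).+2 c2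
  | While r c1 =>
      IJzero r (l + (csize c1).+2) :: compile l.+1 c1 ++ [:: IJump l]
  end.

Lemma size_compile l c : size (compile l c) = csize c.
Proof.
by elim: c l => //= [c1 IH1 c2 IH2|r c1 IH1 c2 IH2|r c1 IH1] l;
  rewrite size_cat /= ?IH1 ?IH2 //; lia.
Qed.

Definition code_at (prog : program) (l : nat) (p : program) :=
  forall i, i < size p -> onth prog (l + i) = onth p i.

Lemma code_at_cat prog l p q :
  code_at prog l (p ++ q) -> code_at prog l p /\ code_at prog (l + size p) q.
Proof.
move=> h; split=> i ip; last first.
  rewrite -addnA h ?size_cat ?ltn_add2l // onth_cat ltnNge leq_addr /=.
  by rewrite addnC addnK.
by rewrite h ?size_cat ?ltn_addr // onth_cat ip.
Qed.

Lemma code_at_cons prog l i p :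
  code_at prog l (i :: p) -> onth prog l = Some i /\ code_at prog l.+1 p.
Proof.
move=> h; split; first by rewrite -[l]addn0 h.
by move=> j jp; rewrite addSnnS h.
Qed.

Lemma step_at prog w p R o i : onth prog p = Some i ->
  step prog w (State p R o) = exec w i (State p R o).
Proof. by rewrite /step /= => ->. Qed.

(** * Total correctness with step counts *)

Section Triples.
Variable w : seq bool.

Definition assertion := (nat -> nat) -> seq bool -> Prop.
Implicit Types (P Q : assertion) (c : cmd).

(* Total correctness within [t] steps, wherever the code of [c] is placed. *)
Definition triple P c t Q := forall prog l R o,
  code_at prog l (compile l c) -> P R o ->
  exists t' R' o', [/\ t' <= t, Q R' o' &
    iter t' (step prog w) (State l R o) = State (l + csize c) R' o'].

Definition straight (i : instr) :=
  match i with IJump _ | IJzero _ _ => false | _ => true end.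

Fixpoint loop_free c :=
  match c with
  | Do i => straight i
  | Seq c1 c2 | If _ c1 c2 => loop_free c1 && loop_free c2
  | While _ _ => false
  end.

(* The weakest precondition of a loop-free command; its value on jumps and
   loops is irrelevant. *)
Fixpoint wp c Q : assertion :=
  match c with
  | Do i => fun R o => let s := exec w i (State 0 R o) in Q (regs s) (out s)
  | Seq c1 c2 => wp c1 (wp c2 Q)
  | If r c1 c2 => fun R o => if R r == 0 then wp c2 Q R o else wp c1 Q R o
  | While _ _ => fun _ _ => False
  end.

Lemma triple_weaken P P' c t t' Q Q' :
  triple P c t Q -> (forall R o, P' R o -> P R o) -> t <= t' ->
  (forall R o, Q R o -> Q' R o) -> triple P' c t' Q'.
Proof.
move=> h PP tt' QQ prog l R o code /PP pre.
have [t1 [R' [o' [le1 post ex]]]] := h _ _ _ _ code pre.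
by exists t1, R', o'; split; [apply: leq_trans tt'|apply: QQ|].
Qed.

Lemma triple_seq P Q c1 c2 t1 t2 Q' :
  triple P c1 t1 Q -> triple Q c2 t2 Q' -> triple P (c1 ;; c2)%C (t1 + t2) Q'.
Proof.
move=> h1 h2 prog l R o /= /code_at_cat[code1]; rewrite size_compile => code2.
move=> pre; have [k1 [R1 [o1 [le1 mid ex1]]]] := h1 _ _ _ _ code1 pre.
have [k2 [R2 [o2 [le2 post ex2]]]] := h2 _ _ _ _ code2 mid.
exists (k2 + k1), R2, o2; split=> //; first by rewrite addnC leq_add.
by rewrite iterD ex1 ex2 addnA.
Qed.

Lemma triple_if P Q r c1 c2 t1 t2 :
  triple (fun R o => P R o /\ R r != 0) c1 t1 Q ->
  triple (fun R o => P R o /\ R r = 0) c2 t2 Q ->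
  triple P (If r c1 c2) (t1 + t2).+2 Q.
Proof.
move=> h1 h2 prog l R o /= /code_at_cons[jz] /code_at_cat[code1].
rewrite size_compile addSn => /code_at_cons[jmp code2] pre.
have [r0|rN0] := eqVneq (R r) 0.
- have [k [R' [o' [le post ex]]]] := h2 _ _ _ _ code2 (conj pre r0).
  exists k.+1, R', o'; split=> //; first by lia.
  by rewrite iterSr (step_at _ _ _ jz) /= r0 ex; congr State; lia.
- have [k [R' [o' [le post ex]]]] := h1 _ _ _ _ code1 (conj pre rN0).
  exists k.+2, R', o'; split=> //; first by lia.
  by rewrite iterSr iterS (step_at _ _ _ jz) /= (negbTE rN0) ex addSn (step_at _ _ _ jmp).
Qed.

Lemma triple_wp c Q : loop_free c -> triple (wp c Q) c (csize c) Q.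
Proof.
elim: c Q => [i|c1 IH1 c2 IH2|r c1 IH1 c2 IH2|//] Q /=.
- move=> si prog l R o code pre; exists 1.
  have ex : step prog w (State l R o) = exec w i (State l R o).
    by apply: step_at; rewrite -[l]addn0 code.
  rewrite [iter _ _ _]ex; case: i si pre {code ex} => //= *;
    by do 2!eexists; split; rewrite ?addn1 //; eassumption.
- by case/andP=> lf1 lf2; apply: triple_seq (IH1 _ lf1) (IH2 _ lf2).
- case/andP=> lf1 lf2; apply: triple_if.
  + by apply: (triple_weaken (IH1 Q lf1)) => // R o [/[swap]/negbTE->].
  + by apply: (triple_weaken (IH2 Q lf2)) => // R o [/[swap]->].
Qed.

Lemma triple_loop_free P c t Q :
  loop_free c -> csize c <= t -> (forall R o, P R o -> wp c Q R o) ->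
  triple P c t Q.
Proof. by move=> lf ct h; apply: (triple_weaken (triple_wp (Q := Q) lf)). Qed.

(** [Inv] is indexed by the number of rounds made, and the induction is on [m - k]. A round costs
    the body, the test and the jump back; the outer [.+1] is the failing test. *)
Lemma triple_while (Inv : nat -> assertion) r c t m k :
  (forall i R o, i < m -> Inv i R o -> R r != 0) ->
  (forall R o, Inv m R o -> R r = 0) ->
  (forall i, i < m -> triple (Inv i) c t (Inv i.+1)) -> k <= m ->
  triple (Inv k) (While r c) ((m - k) * t.+2).+1 (Inv m).
Proof.
move=> pos zero body km prog l R o /= code pre.
have [jz /code_at_cat[codec]] := code_at_cons code.
rewrite size_compile => /code_at_cons[jmp _].
have [d defm] : {d | m = k + d} by exists (m - k); lia.
rewrite {1}defm addKn => {km}.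
elim: d k R o defm pre => [|d IH] k R o defm pre.
  rewrite defm addn0; exists 1, R, o; split=> //.
  by rewrite [iter _ _ _](step_at _ _ _ jz) /= (zero R o) ?eqxx // defm addn0.
have km : k < m by lia.
have [k1 [R1 [o1 [le1 mid ex1]]]] := body k km prog l.+1 R o codec pre.
have [|k2 [R2 [o2 [le2 post ex2]]]] := IH k.+1 R1 o1 _ mid; first by lia.
exists (k2 + k1.+2), R2, o2; split=> //; first by lia.
rewrite iterD iterS iterSr (step_at _ _ _ jz) /= (negbTE (pos _ _ _ km pre)).
by rewrite ex1 (step_at _ _ _ jmp).
Qed.

End Triples.

(* [r_m] holds the order of the output graph, [r_mem] the input address of the
   characteristic vector of the terminals, [r_t] the terminal selected as hub and
   [r_row] the input address of the current row of the adjacency matrix. *)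
Notation r_one := 0 (only parsing).
Notation r_n := 1 (only parsing).
Notation r_m := 2 (only parsing).
Notation r_mem := 3 (only parsing).
Notation r_t := 4 (only parsing).
Notation r_row := 5 (only parsing).
Notation r_i := 6 (only parsing).
Notation r_j := 7 (only parsing).
Notation r_di := 8 (only parsing).
Notation r_dj := 9 (only parsing).
Notation r_x := 10 (only parsing).
Notation r_y := 11 (only parsing).
Notation r_u := 12 (only parsing).
Notation r_v := 13 (only parsing).

(** The only conditional jump tests for zero, so [d] holds [lim - i] and controls the loop. *)
Definition for_loop (i d lim : nat) (c : cmd) : cmd :=
  (IConst i 0 ;; ISub d lim i ;;
   While d (c ;; IAdd i i r_one ;; ISub d lim i))%C.

(** A round adds four steps to the body: two update the counters, two are the test and the jump. The
    final [3] counts the two initialisations and the last test. *)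
Lemma triple_for w (P : nat -> assertion) (i d lim : nat) c t m :
  uniq [:: i; d; lim; r_one] ->
  (forall k R R' o, (forall r, r != i -> r != d -> R' r = R r) ->
     P k R o -> P k R' o) ->
  (forall k R o, P k R o -> R lim = m /\ R r_one = 1) ->
  (forall k, k < m ->
     triple w (fun R o => P k R o /\ R i = k) c t
              (fun R o => P k.+1 R o /\ R i = k)) ->
  triple w (P 0) (for_loop i d lim c) (m * (t + 4) + 3) (P m).
Proof.
rewrite /= !inE !negb_or -!andbA => /and5P[id_ il i1 dl /and3P[d1 l1 _]].
move=> frame lims body.
pose Inv k R o := [/\ P k R o, R i = k & R d = m - k].
have -> : m * (t + 4) + 3 = 1 + (1 + (m * (t + 4) + 1)) by lia.
apply: (@triple_seq _ _ (fun R o => P 0 R o /\ R i = 0)).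
  apply: triple_loop_free => // R o pre /=; split; last by rewrite /upd eqxx.
  by apply: frame pre => r ri rd; rewrite /upd (negbTE ri).
apply: (@triple_seq _ _ (Inv 0)).
  apply: triple_loop_free => // R o [pre i0] /=; split.
  - by apply: frame pre => r ri rd; rewrite /upd (negbTE rd).
  - by rewrite /upd (negbTE id_).
  - by rewrite /upd eqxx i0 (lims _ _ _ pre).1.
apply: (@triple_weaken _ (Inv 0) _ _ ((m - 0) * (t + 2).+2).+1 _ (Inv m)) => //.
- apply: triple_while => // [k R o km [_ _ ->]|R o [_ _ ->]|k km]; try lia.
  apply: (@triple_seq _ _ (fun R o => P k.+1 R o /\ R i = k)).
    by apply: (triple_weaken (body k km)) => // R o [].
  apply: triple_loop_free => // R o [pre ik] /=.
  have [liml one] := lims _ _ _ pre.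
  split.
  - by apply: frame pre => r ri rd; rewrite /upd (negbTE ri) (negbTE rd).
  - by rewrite /upd (negbTE id_) eqxx ik one addn1.
  - by rewrite /upd eqxx eq_sym (negbTE il) eqxx liml ik one addn1.
- by lia.
- by move=> R o [].
Qed.

(** * The program computing the reduction *)

(** Besides filling an empty branch it clears the result bit, on which [member_cmd] relies for the
    vertices of the copy of [G]. *)
Definition skip : cmd := IConst r_x 0.

(** At least one of the two truncated differences is zero, so their sum is the distance of the two
    contents; it vanishes exactly when they are equal. *)
Definition dist_cmd (x a b : nat) : cmd :=
  (ISub r_y a b ;; ISub x b a ;; IAdd x x r_y)%C.

Definition link_cmd : cmd :=
  (IAdd r_x r_mem r_v ;; IRead r_x r_x ;;
   If r_x
     (dist_cmd r_x r_v r_t ;;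
      If r_x
        (dist_cmd r_x r_u r_v ;;
         If r_x
           (dist_cmd r_x r_u r_t ;; If r_x (IConst r_x 0) (IConst r_x 1))
           (IConst r_x 1))
        skip)
     skip)%C.

(** [r_x] and [r_y] are nonzero when the row and the column belong to the copy of [G]. For want of a
    copy instruction, an index is copied by adding the one of them found to be zero. *)
Definition entry_cmd : cmd :=
  (ISub r_x r_n r_i ;; ISub r_y r_n r_j ;;
   If r_x
     (If r_y
        (IAdd r_x r_row r_j ;; IRead r_x r_x)
        (ISub r_v r_j r_n ;; IAdd r_u r_i r_y ;; link_cmd))
     (If r_y
        (ISub r_v r_i r_n ;; IAdd r_u r_j r_x ;; link_cmd)
        skip) ;;
   IWrite r_x)%C.

Definition member_cmd : cmd :=
  (ISub r_x r_n r_i ;;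
   If r_x
     skip
     (ISub r_v r_i r_n ;; IAdd r_x r_mem r_v ;; IRead r_x r_x ;;
      If r_x (dist_cmd r_x r_v r_t) skip) ;;
   IWrite r_x)%C.

(** The order is encoded in unary and is found by counting leading ones, starting from the initial
    content 0 of [r_n]. *)
Definition order_cmd : cmd :=
  (IConst r_one 1 ;; IRead r_x r_n ;;
   While r_x (IAdd r_n r_n r_one ;; IRead r_x r_n))%C.

(** Without multiplication, the characteristic vector is located from the end of the input, as its
    last [n] bits. The hub becomes the last terminal, or 0 if there is none. *)
Definition terminal_cmd : cmd :=
  ((ISize r_mem ;; ISub r_mem r_mem r_n ;; IAdd r_m r_n r_n ;; IConst r_t 0) ;;
   for_loop r_i r_di r_n
     (IAdd r_x r_mem r_i ;; IRead r_x r_x ;;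
      If r_x (IConst r_y 0 ;; IAdd r_t r_i r_y) skip))%C.

(** Adding [r_n] to [r_row] after each row replaces the product [i * n] in the row address. *)
Definition output_cmd : cmd :=
  (for_loop r_i r_di r_m (IWrite r_one) ;;
   (IConst r_x 0 ;; IWrite r_x ;; IAdd r_row r_n r_one) ;;
   for_loop r_i r_di r_m
     (for_loop r_j r_dj r_m entry_cmd ;; IAdd r_row r_row r_n) ;;
   for_loop r_i r_di r_m member_cmd)%C.

(** It runs only when [r_n] is 0, so writing [r_n] emits a 0; the four bits encode
    [point_instance]. *)
Definition trivial_cmd : cmd :=
  (IWrite r_one ;; IWrite r_n ;; IWrite r_n ;; IWrite r_one)%C.

Definition reduction_cmd : cmd :=
  (order_cmd ;; terminal_cmd ;; If r_n output_cmd trivial_cmd)%C.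

Lemma entry_cmd_size : loop_free entry_cmd /\ csize entry_cmd <= 64.
Proof. by []. Qed.

Lemma member_cmd_size : loop_free member_cmd /\ csize member_cmd <= 14.
Proof. by []. Qed.

(** * Output and running time of the program *)

Section ProgramCorrectness.
Variables (w : seq bool) (n : nat) (w' : seq bool).
Hypothesis def_w : w = nseq n true ++ false :: w'.

(** These functions describe the intended output through the bits of [w] alone, independently of any
    graph. *)
Definition word_mem v := nth false w (size w - n + v).
Definition word_adj i j := nth false w (n.+1 + i * n + j).
Definition word_link t v u :=
  [&& word_mem v, v != t & (u == v) || (u == t)].
Definition word_entry t i j :=
  if i < n then if j < n then word_adj i j else word_link t (j - n) i
  else (j < n) && word_link t (i - n) j.
Definition word_member t i :=
  [&& n <= i, word_mem (i - n) & i - n != t].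
Definition word_matrix t k :=
  flatten (mkseq (fun i => mkseq (word_entry t i) (n + n)) k).
Definition word_graph t :=
  nseq (n + n) true ++ false :: word_matrix t (n + n) ++
  mkseq (word_member t) (n + n).

(** As an implication it allows an arbitrary hub when there is no terminal; it yields the hypothesis
    [t0_T] of the reduction. *)
Definition chosen t := forall v, v < n -> word_mem v -> word_mem t.

Definition env t (R : nat -> nat) :=
  [/\ R r_one = 1, R r_n = n, R r_m = n + n, R r_mem = size w - n
    & R r_t = t].

Lemma dist_eq0 (a b : nat) : (b - a + (a - b) == 0) = (a == b).
Proof. lia. Qed.

Definition same_but_xy (R R' : nat -> nat) :=
  forall r, r != r_x -> r != r_y -> R' r = R r.

Lemma env_same_but_xy t R R' : same_but_xy R R' -> env t R -> env t R'.
Proof. by move=> h [? ? ? ? ?]; rewrite /env !h. Qed.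

Lemma wp_dist (a b : nat) Q R o :
  a != r_x -> a != r_y -> b != r_x -> b != r_y ->
  (forall R', same_but_xy R R' -> (R' r_x == 0) = (R a == R b) -> Q R' o) ->
  wp w (dist_cmd r_x a b) Q R o.
Proof.
move=> /negbTE ax /negbTE ay /negbTE bx /negbTE by_ post.
rewrite /= /upd /= ay by_; apply: post => [r /negbTE rx /negbTE ry|].
  by rewrite rx ry.
by rewrite dist_eq0.
Qed.

#[local] Opaque dist_cmd.

Lemma wp_link Q t R o : env t R ->
  (forall R', same_but_xy R R' ->
     (R' r_x != 0) = word_link t (R r_v) (R r_u) -> Q R' o) ->
  wp w link_cmd Q R o.
Proof.
move=> [_ _ _ mem_ t_] post; rewrite /= /upd /= mem_ -/(word_mem (R r_v)).
rewrite /word_link in post.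
case: (word_mem _) post => /= post; last first.
  by apply: post => // r /negbTE rx _; rewrite rx.
apply: wp_dist => // R1 same1; rewrite /= t_ => ->.
case: (R r_v == t) post => /= post.
  apply: post => // r rx ry; rewrite (negbTE rx) same1 //= (negbTE rx) //.
apply: wp_dist => // R2 same2; rewrite !same1 //= => ->.
case: (R r_u == R r_v) post => /= post.
  apply: post => // r rx ry.
  by rewrite (negbTE rx) same2 //= same1 //= (negbTE rx).
apply: wp_dist => // R3 same3; rewrite !same2 // !same1 //= t_ => ->.
by case: (R r_u == t) post => /= post; apply: post => // r rx ry;
  rewrite (negbTE rx) same3 //= same2 //= same1 //= (negbTE rx).
Qed.

#[local] Opaque link_cmd.

Lemma triple_entry t i j o0 :
  triple w
    (fun R o => [/\ env t R, R r_row = n.+1 + i * n, R r_i = i, R r_j = j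
                  & o = o0])
    entry_cmd 64
    (fun R o => [/\ env t R, R r_row = n.+1 + i * n, R r_i = i, R r_j = j
                  & o = rcons o0 (word_entry t i j)]).
Proof.
apply: triple_loop_free entry_cmd_size.1 entry_cmd_size.2 _ => R o [e row ri rj ->].
have [_ rn _ _ _] := e.
rewrite /= /upd /= rn ri rj !subn_eq0 /word_entry.
rewrite ![n <= _]leqNgt; case: ltnP => ni /=; case: ltnP => nj /=.
- rewrite row; split=> //.
  by rewrite -/(word_adj i j); case: word_adj.
- apply: (wp_link (t := t)) => // R' same val.
  rewrite /= val; split; rewrite ?same //=; last first.
    by rewrite (eqP (_ : n - j == 0)) ?subn_eq0 // addn0.
  by apply: (env_same_but_xy same).
- apply: (wp_link (t := t)) => // R' same val.
  rewrite /= val; split; rewrite ?same //=; last first.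
    by rewrite (eqP (_ : n - i == 0)) ?subn_eq0 // addn0.
  by apply: (env_same_but_xy same).
- by split.
Qed.

Lemma triple_member t i o0 :
  triple w (fun R o => [/\ env t R, R r_i = i & o = o0])
    member_cmd 14
    (fun R o => [/\ env t R, R r_i = i & o = rcons o0 (word_member t i)]).
Proof.
apply: triple_loop_free member_cmd_size.1 member_cmd_size.2 _ => R o [e ri ->].
have [_ rn _ mem_ t_] := e.
rewrite /= /upd /= rn ri mem_ subn_eq0 -/(word_mem _).
rewrite /word_member; case: leqP => ni /=; last first.
  by split.
case: word_mem => /=; last by split.
apply: wp_dist => // R' same; rewrite /= t_ => ->; split; rewrite ?same //.
by apply: (env_same_but_xy same).
Qed.

Lemma triple_order :
  triple w (fun R o => (forall r, R r = 0) /\ o = [::]) order_cmd (n * 4 + 3)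
    (fun R o => [/\ R r_one = 1, R r_n = n & o = [::]]).
Proof.
pose Inv k (R : nat -> nat) (o : seq bool) :=
  [/\ R r_one = 1, R r_n = k, R r_x = (k < n) & o = [::]].
(* At [k = n] the bit read is the 0 that ends the unary order. *)
have bit k : k <= n -> nth false w k = (k < n).
  move=> kn; rewrite def_w nth_cat size_nseq nth_nseq.
  by case: ltnP => // nk; rewrite (eqP (_ : k - n == 0)) ?subn_eq0.
have -> : n * 4 + 3 = 1 + (1 + (n * 4 + 1)) by lia.
apply: (@triple_seq _ _ (fun R o => [/\ R r_one = 1, R r_n = 0 & o = [::]])).
  by apply: triple_loop_free => // R o [R0 ->] /=; rewrite /upd /= R0.
apply: (@triple_seq _ _ (Inv 0)).
  apply: triple_loop_free => // R o [r1 rn ->] /=.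
  by split; rewrite /upd //= rn bit.
apply: (@triple_weaken _ (Inv 0) _ _ ((n - 0) * 4).+1 _ (Inv n)) => //.
- apply: triple_while => // [k R o kn [_ _ -> _]|R o [_ _ -> _]|k kn].
  + by rewrite kn.
  + by rewrite ltnn.
  + apply: triple_loop_free => // R o [r1 rn rx ->] /=.
    by split; rewrite /upd //= rn r1 addn1 // bit.
- by lia.
- by move=> R o [].
Qed.

Lemma triple_terminal :
  triple w (fun R o => [/\ R r_one = 1, R r_n = n & o = [::]])
    terminal_cmd (n * 11 + 7)
    (fun R o => exists t, [/\ env t R, 0 < n -> t < n, chosen t & o = [::]]).
Proof.
pose Inv k (R : nat -> nat) (o : seq bool) := exists t,
  [/\ env t R, 0 < n -> t < n, forall v, v < k -> word_mem v -> word_mem t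
    & o = [::]].
have -> : n * 11 + 7 = 4 + (n * (7 + 4) + 3) by lia.
apply: (@triple_seq _ _ (Inv 0)).
  (* The initial hub 0 is a vertex only if the order is positive, hence the guard [0 < n] in
     [Inv]. *)
  apply: triple_loop_free => // R o [r1 rn ->]; exists 0.
  by rewrite /env /= /upd /= rn.
apply: (triple_for (P := Inv)) => //.
- move=> k R R' o same [t [e tn ch ->]]; exists t; split=> //.
  by case: e => ? ? ? ? ?; rewrite /env !same.
- by move=> k R o [t [[? ?] _ _ _]].
- move=> k kn; apply: triple_loop_free => // R o [[t [e tn ch ->]] ri] /=.
  have [r1 rn rm mem_ t_] := e.
  rewrite /upd /= mem_ ri -/(word_mem k).
  case memk: word_mem => /=; split=> //.
  + by exists k; split; rewrite ?addn0.
  + exists t; split=> // v; rewrite ltnS leq_eqVlt => /predU1P[->|vk].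
      by rewrite memk.
    exact: ch.
Qed.

Lemma word_matrixS t k :
  word_matrix t k.+1 = word_matrix t k ++ mkseq (word_entry t k) (n + n).
Proof. by rewrite /word_matrix mkseqS flatten_rcons. Qed.

Lemma triple_output t :
  triple w (fun R o => env t R /\ o = [::]) output_cmd
    ((n + n) * (1 + 4) + 3 + (3 +
     ((n + n) * ((n + n) * (64 + 4) + 3 + 1 + 4) + 3 +
      ((n + n) * (14 + 4) + 3))))
    (fun R o => o = word_graph t).
Proof.
pose hd := nseq (n + n) true ++ [:: false].
pose row i (R : nat -> nat) := R r_row = n.+1 + i * n.
apply: (@triple_seq _ _ (fun R o => env t R /\ o = nseq (n + n) true)).
  apply: (triple_for (P := fun k R o => env t R /\ o = nseq k true)) => //.
  - by move=> k R R' o same [[? ? ? ? ?] ->]; rewrite /env !same.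
  - by move=> k R o [[]].
  - move=> k km; apply: triple_loop_free => // R o [[e ->] ri] /=.
    by have [-> _ _ _ _] := e; rewrite -cats1 -(nseqD k 1) addn1.
apply: (@triple_seq _ _ (fun R o => [/\ env t R, row 0 R & o = hd])).
  apply: triple_loop_free => // R o [e ->] /=.
  have [r1 rn _ _ _] := e.
  by split=> //; rewrite ?/row /upd /= ?rn ?r1 ?addn1 ?addn0 // -cats1.
apply: (@triple_seq _ _
    (fun R o => env t R /\ o = hd ++ word_matrix t (n + n))).
  pose P k R o := [/\ env t R, row k R & o = hd ++ word_matrix t k].
  apply: (@triple_weaken _ (P 0) _
    _ ((n + n) * ((n + n) * (64 + 4) + 3 + 1 + 4) + 3) _ (P (n + n))) => //;
    first last.
  - by move=> R o [].
  - by move=> R o [e rr ->]; split; rewrite ?cats0.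
  apply: (triple_for (P := P)) => //.
  - by move=> k R R' o same [[? ? ? ? ?] rr ->]; rewrite /P /env /row !same.
  - by move=> k R o [[]].
  move=> i im.
  pose I j R o := [/\ env t R, row i R, R r_i = i
    & o = hd ++ word_matrix t i ++ mkseq (word_entry t i) j].
  apply: (@triple_seq _ _ (I (n + n))); last first.
    apply: triple_loop_free => // R o [e rr ri ->] /=.
    have [_ rn _ _ _] := e; rewrite /P word_matrixS; split=> //; split=> //.
    by rewrite /row /upd /= rr rn; lia.
  apply: (@triple_weaken _ (I 0) _ _ ((n + n) * (64 + 4) + 3) _ (I (n + n))) => //.
  - apply: (triple_for (P := I)) => //.
    + by move=> k R R' o same [[? ? ? ? ?] rr ri ->]; rewrite /I /env /row !same.
    + by move=> k R o [[]].
    + move=> j jm; pose o0 := hd ++ word_matrix t i ++ mkseq (word_entry t i) j.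
      apply: (triple_weaken (@triple_entry t i j o0)) => // R o.
        by case=> [[]].
      case=> e rr ri rj ->; split=> //; split=> //.
      by rewrite mkseqS -!rcons_cat.
  - by move=> R o [[e rr ->] ri]; split; rewrite ?cats0.
pose P k R o := env t R /\
  o = (hd ++ word_matrix t (n + n)) ++ mkseq (word_member t) k.
apply: (@triple_weaken _ (P 0) _ _ ((n + n) * (14 + 4) + 3) _ (P (n + n))) => //.
- apply: (triple_for (P := P)) => //.
  + by move=> k R R' o same [[? ? ? ? ?] ->]; rewrite /P /env !same.
  + by move=> k R o [[]].
  + move=> i im.
    pose o0 := (hd ++ word_matrix t (n + n)) ++ mkseq (word_member t) i.
    apply: (triple_weaken (@triple_member t i o0)) => // R o.
      by case=> [[]].
    by case=> e ri ->; split=> //; split=> //; rewrite mkseqS -!rcons_cat.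
- by move=> R o [e ->]; split; rewrite ?cats0.
- by move=> R o [_ ->]; rewrite /word_graph /hd -!catA.
Qed.

(** The hub stays existential, since every admissible choice gives a correct reduction. *)
Definition reduced_word o :=
  if n == 0 then o = [:: true; false; false; true]
  else exists2 t, t < n /\ chosen t & o = word_graph t.

Lemma triple_branch t : (0 < n -> t < n) -> chosen t ->
  triple w (fun R o => env t R /\ o = [::]) (If r_n output_cmd trivial_cmd)
    (285 * n.+1 ^ 2) (fun _ o => reduced_word o).
Proof.
(* Both branches and the two jumps add up to [272 * n ^ 2 + 62 * n + 18] steps. *)
move=> tn ch; apply: (triple_weaken (triple_if
  (P := fun R o => env t R /\ o = [::]) (Q := fun _ o => reduced_word o)
  (t1 := (n + n) * 5 + 3 +
     (3 + ((n + n) * ((n + n) * 68 + 8) + 3 + ((n + n) * 18 + 3))))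
  (t2 := 4) _ _)) => //; last by rewrite expnS expn1; nia.
- have [n0|n0] := posnP n.
    by move=> prog l R o _ [[[_ -> _ _ _] _]]; rewrite n0.
  apply: (triple_weaken (triple_output (t := t))) => // [R o [//]||R o ->].
    by lia.
  by rewrite /reduced_word eqn0Ngt n0; exists t => //; split=> //; apply: tn.
- apply: triple_loop_free => // R o [[e ->] rn0] /=.
  have [r1 rn _ _ _] := e.
  by rewrite r1 rn0 /reduced_word -rn rn0.
Qed.

Lemma reduction_cmd_correct :
  triple w (fun R o => (forall r, R r = 0) /\ o = [::]) reduction_cmd
    (300 * n.+1 ^ 2) (fun _ o => reduced_word o).
Proof.
have branch : triple w
    (fun R o => exists t, [/\ env t R, 0 < n -> t < n, chosen t & o = [::]])
    (If r_n output_cmd trivial_cmd) (285 * n.+1 ^ 2)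
    (fun _ o => reduced_word o).
  move=> prog l R o code [t [e tn ch o0]].
  exact: (triple_branch tn ch code (conj e o0)).
(* The first two phases take [15 * n + 10] steps, which raises the constant from 285 to 300. *)
apply: (triple_weaken (triple_seq triple_order
  (triple_seq triple_terminal branch))) => //.
by rewrite expnS expn1; nia.
Qed.

Definition reduction_program : program := compile 0 reduction_cmd.

Lemma iter_halted prog k st :
  size prog <= pc st -> iter k (step prog w) st = st.
Proof.
move=> halted; elim: k => // k IH; rewrite iterS IH /step.
by rewrite onth_default.
Qed.

Lemma reduction_program_outputs T : 300 * n.+1 ^ 2 <= T ->
  exists2 o, reduced_word o & outputs_within reduction_program w T o.
Proof.
move=> leT; have code : code_at reduction_program 0 reduction_program by [].
have [k [R [o [kt post ex]]]] :=
  reduction_cmd_correct code (conj (fun=> erefl) erefl).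
exists o => //; rewrite /outputs_within -(subnK (leq_trans kt leT)) iterD ex.
by rewrite iter_halted /= ?size_compile.
Qed.

End ProgramCorrectness.

(** * The reduction on instances *)

Lemma map_enum_ord (X : Type) n (g : 'I_n -> X) (F : nat -> X) :
  (forall x : 'I_n, F x = g x) -> [seq g x | x <- enum 'I_n] = mkseq F n.
Proof.
by move=> Fg; rewrite /mkseq -val_enum_ord -map_comp; apply: eq_map => x /=.
Qed.

Lemma allpairs_enum_ord (X : Type) n (g : 'I_n -> 'I_n -> X)
    (F : nat -> nat -> X) :
  (forall x y : 'I_n, F x y = g x y) ->
  [seq g x y | x <- enum 'I_n, y <- enum 'I_n] =
  flatten (mkseq (fun i => mkseq (F i) n) n).
Proof.
move=> Fg; congr flatten; apply: map_enum_ord => x.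
by rewrite (map_enum_ord (Fg x)).
Qed.

Lemma size_flatten_mkseq (X : Type) (F : nat -> nat -> X) m k :
  size (flatten (mkseq (fun i => mkseq (F i) m) k)) = k * m.
Proof.
elim: k => // k IH.
by rewrite mkseqS flatten_rcons size_cat IH size_mkseq mulSn addnC.
Qed.

Lemma nth_flatten_mkseq (X : Type) x0 (F : nat -> nat -> X) m k i j :
  i < k -> j < m ->
  nth x0 (flatten (mkseq (fun i => mkseq (F i) m) k)) (i * m + j) = F i j.
Proof.
move=> ik jm; elim: k ik => // k IH; rewrite ltnS => ik.
rewrite mkseqS flatten_rcons nth_cat size_flatten_mkseq.
have [eq_ik|neq_ik] := eqVneq i k.
  by rewrite eq_ik ltnNge leq_addr addKn nth_mkseq.
have {}ik : i < k by rewrite ltn_neqAle neq_ik.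
by rewrite (_ : _ < _) ?IH //; nia.
Qed.

(** * From bit strings back to graphs *)

Section Encoding.
Variables (G : sgraph) (T : {set vertex G}).
Let n := order_of G.
Let w := encode_graph_with_set (GraphWithSet T).

Definition nat_adj (i j : nat) : bool :=
  if @insub _ _ (vertex G) i is Some x then
    if insub j is Some y then adj x y else false
  else false.

Definition nat_mem (v : nat) : bool :=
  if insub v is Some x then x \in T else false.

Lemma encodeE : w = nseq n true ++ false ::
  flatten (mkseq (fun i => mkseq (nat_adj i) n) n) ++ mkseq nat_mem n.
Proof.
congr (_ ++ _ :: _ ++ _).
- by apply: allpairs_enum_ord => x y; rewrite /nat_adj !valK.
- by apply: map_enum_ord => x; rewrite /nat_mem valK.
Qed.

(** The lengths [n + 1], [n * n] and [n] of the blocks sum to a square, so the quadratic running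
    time is linear in the input length. *)
Lemma size_encode : size w = n.+1 ^ 2.
Proof.
rewrite encodeE size_cat /= size_cat size_flatten_mkseq size_mkseq size_nseq.
by rewrite expnS expn1; lia.
Qed.

Lemma word_adj_encode (x y : vertex G) : word_adj w n x y = adj x y.
Proof.
have [xn yn] := (ltn_ord x, ltn_ord y).
rewrite /word_adj encodeE nth_cat size_nseq ltnNge -!addnA addSnnS leq_addr /=.
rewrite addKn /= nth_cat size_flatten_mkseq (_ : _ < _); last by nia.
by rewrite nth_flatten_mkseq // /nat_adj !valK.
Qed.

Lemma word_mem_encode (v : vertex G) : word_mem w n v = (v \in T).
Proof.
rewrite /word_mem size_encode encodeE -cat_cons !catA nth_cat.
rewrite !size_cat size_nseq /= size_flatten_mkseq.
have -> : n.+1 ^ 2 - n = n + (n * n).+1 by rewrite expnS expn1; lia.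
by rewrite ltnNge leq_addr addKn nth_mkseq // /nat_mem valK.
Qed.

Variable t0 : vertex G.

(* [inr v] is the vertex hung on the terminals [v] and [t0]; it is isolated
   unless [v] is a terminal other than [t0]. *)
Definition hung_adj : rel 'I_(n + n) := fun a b =>
  match split a, split b with
  | inl x, inl y => adj x y
  | inl x, inr v | inr v, inl x => (v \in T :\ t0) && ((x == v) || (x == t0))
  | inr _, inr _ => false
  end.

Lemma hung_adj_sym : symmetric hung_adj.
Proof.
by move=> a b; rewrite /hung_adj; case: (split a) (split b) => [x|u] [y|v] //;
  rewrite adj_sym.
Qed.

Lemma hung_adj_irr : irreflexive hung_adj.
Proof.
by move=> a; rewrite /hung_adj; case: (split a) => // x; rewrite adj_irr.
Qed.

Definition hung_graph := SGraph hung_adj_sym hung_adj_irr.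

Definition hung_instance : graph_with_set :=
  @GraphWithSet hung_graph (@rshift n n @: (T :\ t0)).

(** The comparisons with [n] in [word_entry] and [word_member] correspond to the two cases of
    [split]. *)
Lemma encode_hung_instance :
  encode_graph_with_set hung_instance = word_graph w n t0.
Proof.
rewrite /= /word_graph /word_matrix; congr (_ ++ _ :: _ ++ _).
- apply: allpairs_enum_ord => a b; rewrite /hung_adj /word_entry /word_link.
  by case: splitP => [x|v] ->; case: splitP => [y|u] ->;
    rewrite ?ltn_ord ?ltnNge ?leq_addr ?addKn //= ?word_adj_encode
            ?word_mem_encode // !inE andbCA -andbA.
- apply: map_enum_ord => a; rewrite /word_member.
  case: (fintype.splitP a) => [x defa|v defa].
    have -> : a = lshift n x by apply: val_inj.
    rewrite leqNgt /= ltn_ord /=; symmetry; apply/imsetP => -[v _ /eqP].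
    by rewrite eq_lrshift.
  have -> : a = rshift n v by apply: val_inj.
  rewrite mem_imset; last exact: rshift_inj.
  by rewrite /= leq_addr addKn word_mem_encode in_setD1 [RHS]andbC.
Qed.

Lemma hung_instance_equiv : (T != set0 -> t0 \in T) ->
  yes_instance (p := k_in_a_Tree) (GraphWithSet T) <->
  yes_instance (p := Minimal_FVS_Extension) hung_instance.
Proof.
move=> t0T.
pose f : vertex G -> vertex hung_graph := @lshift n n.
pose s : vertex G -> vertex hung_graph := @rshift n n.
have splitl x : split (f x) = inl x := unsplitK (inl x).
have splitr v : split (s v) = inr v := unsplitK (inr v).
have f_inj : injective f by apply: lshift_inj.
have f_adj x y : adj (f x) (f y) = adj x y.
  by rewrite /= /hung_adj !splitl.
have s_codom v : s v \notin codom f.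
  by apply/codomP=> -[x /eqP]; rewrite eq_rlshift.
have s_adj v : v \in T :\ t0 ->
    forall z, adj (s v) z = (z == f v) || (z == f t0).
  move=> vT z; rewrite /= /hung_adj splitr.
  case: (fintype.splitP z) => [x defz|u defz].
    have -> : z = f x by apply: val_inj.
    by rewrite vT !(inj_eq f_inj).
  have -> : z = s u by apply: val_inj.
  by rewrite !eq_rlshift.
have adj_s x z : z \notin codom f -> adj (f x) z -> z \in s @: (T :\ t0).
  rewrite /= /hung_adj splitl; case: (fintype.splitP z) => [y defz|u defz].
    have -> : z = f y by apply: val_inj.
    by rewrite codom_f.
  have -> : z = s u by apply: val_inj.
  by move=> _ /andP[uT _]; apply: imset_f.
split=> /= [[A [TA treeA]]|[S [sS minS]]].
- have [S sS minS] := minimal_fvs_of_tree f_inj f_adj s_codom s_adj t0T TA treeA.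
  by exists S.
- have [A TA treeA] := tree_of_minimal_fvs f_inj f_adj s_adj adj_s sS minS.
  by exists A.
Qed.

End Encoding.

Lemma card_hung_set (G : sgraph) (T : {set vertex G}) t0 :
  #|Defs.set_of (hung_instance T t0)| <= #|T|.
Proof.
rewrite /= card_imset; last exact: rshift_inj.
by rewrite subset_leq_card // subsetDl.
Qed.

(* The graph of order 0 has no tree even for [T = set0], whereas the empty set
   always extends to a minimal feedback vertex set.  Hence the empty graph is
   mapped to a single vertex, which belongs to no minimal feedback vertex set. *)
Definition point_graph : sgraph :=
  @SGraph 1 (fun _ _ => false) (fun _ _ => erefl) (fun=> erefl).

Definition point_instance : graph_with_set := @GraphWithSet point_graph setT.

Lemma encode_point_instance :
  encode_graph_with_set point_instance = [:: true; false; false; true].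
Proof. by rewrite /= !enum_ordSl !enum_ord0 /= inE. Qed.

(** The graph has no edge, so [set0] is already a feedback vertex set, properly inside any set that
    contains the vertex. *)
Lemma point_instance_no :
  ~ yes_instance (p := Minimal_FVS_Extension) point_instance.
Proof.
move=> [S [subS [_ /(_ set0)]]]; rewrite properE sub0set subset0 /=.
case; first by apply/set0Pn; exists ord0; apply: (subsetP subS); rewrite inE.
by move=> [[|x [|y c]] [//= _ /andP[/andP[/and3P[]]]]].
Qed.

Theorem theorem16 : fpt_reducible k_in_a_Tree Minimal_FVS_Extension.
Proof.
(* Exponent 1 suffices because the input has length [n.+1 ^ 2]. The parameter bound is [succn] since
   the empty graph, of parameter 0, is sent to [point_instance], of parameter 1. *)
exists reduction_program, (fun=> 300), succn, 1 => -[G T].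
set w := encode _.
have wE := encodeE T; have szw := size_encode T.
have [|o] := reduction_program_outputs wE (T := 300 * (size w).+1 ^ 1).
  by rewrite szw expn1 leq_mul2l leqnSn.
rewrite /reduced_word; case: eqVneq => [n0 -> run|n0 [t [tn ch] -> run]].
  exists point_instance; split; last by rewrite /= cardsT card_ord.
  - by rewrite -encode_point_instance in run.
  - split=> [[A [_ [[/set0Pn[x _] _] _]]]|/point_instance_no//].
    by case: x => m; rewrite n0.
exists (hung_instance T (Ordinal tn)); split.
- by rewrite -(encode_hung_instance T (Ordinal tn)) in run.
- apply: hung_instance_equiv => /set0Pn[v vT].
  by rewrite -word_mem_encode; apply: (ch v); rewrite ?word_mem_encode.
- exact: leq_trans (card_hung_set _ _) (leqnSn _).
Qed.
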